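(* Let $k,r\ge 1$ be integers, $p\in(0,1)$, $q=1-p$. Let $Y$ be the waiting time for the $r$-th nonoverlapping success run of length $k$ (negative binomial distribution $\mathrm{NB}_{k,r}$ of Type I), and let $Z=Y-rk$. For $j\ge 1$ put $$\tilde C_j=\frac{1}{q^jp^k}\left[(1-p^k)A_j(p)-p^k\sum_{i=1}^{j}\binom{j}{i}(kq)^iA_{j-i}(p)\right],$$ where $A_i$ are the Eulerian polynomials. Then for every integer $n\ge 1$ the raw moment $M_n=\mathbb{E}[Z^n]$ is $$M_n=n!\sum_{n_1+2n_2+\dots+kn_k=n}(r+s_n-1)_{s_n}\prod_{j=1}^k\frac{1}{n_j!}\left(\frac{\tilde C_j}{j!}\right)^{n_j},$$ where the sum is over all $k$-tuples $(n_1,\dots,n_k)$ of nonnegative integers with $\sum_{j=1}^k jn_j=n$, and $s_n=n_1+\dots+n_k$.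
   Context: Consider independent Bernoulli trials, indexed $1,2,3,\dots$, each with success probability $p$. Success runs of length $k$ are counted in the nonoverlapping sense: as soon as $k$ consecutive successes are attained, a run is counted and the counting for a new run begins from scratch with the next trial. $Y$ is the index of the trial at which the $r$-th such run is completed; equivalently, $Y$ is the sum of $r$ independent copies of the waiting time for the first run of $k$ consecutive successes. Notation: $(x)_n=x(x-1)\cdots(x-n+1)$ is the falling factorial, with $(x)_0=1$. The Eulerian polynomials $A_i(t)$ are defined by $\sum_{i=0}^\infty A_i(t)\frac{x^i}{i!}=\frac{t-1}{t-e^{(t-1)x}}$; thus $A_0(t)=A_1(t)=1$, $A_2(t)=1+t$, $A_3(t)=1+4t+t^2$.
   Formalization: The sum over k-tuples (k the run length) is false for n>k: k=r=1, n=2 gives 2q²/p², not (q+q²)/p². The formal sum and product run over m-tuples with n_1+2n_2+...+m n_m=n for any m≥n; m=k is the printed formula when n≤k, and m=n covers every n. *)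

(* Defs.v *)
From HB Require Import structures.
From mathcomp Require Import all_boot all_order all_algebra.
From mathcomp Require Import all_classical all_reals all_analysis.

Set Implicit Arguments.
Unset Strict Implicit.
Unset Printing Implicit Defensive.

Import Order.TTheory GRing.Theory Num.Theory.
Import numFieldNormedType.Exports.
Local Open Scope classical_set_scope.
Local Open Scope ring_scope.

Definition mutually_independent d (T : measurableType d) (R : realType)
    (P : probability T R) d' (T' : measurableType d')
    (X : nat -> {RV P >-> T'}) : Prop :=
  forall (s : seq nat) (B : nat -> set T'), uniq s ->
    (forall i, measurable (B i)) ->
    P [set w | forall i, i \in s -> B i (X i w)] =
    (\prod_(i <- s) P (X i @^-1` B i))%E.

Definition bernoulli_trials d (T : measurableType d) (R : realType)
    (P : probability T R) (p : R) (X : nat -> {RV P >-> bool}) : Prop :=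
  mutually_independent X /\
  forall (i : nat) (B : set bool), distribution P (X i) B = bernoulli_prob p B.

(* The trials 1, 2, 3, ... are x 0, x 1, x 2, ...: trial m.+1 is x m.
   After m trials, [run_state k x m] is the pair made of the number of
   nonoverlapping success runs of length k already counted and of the length
   (< k) of the current streak of successes, which restarts from 0 after a
   failure and each time a run is counted. *)
Fixpoint run_state (k : nat) (x : nat -> bool) (m : nat) : nat * nat :=
  if m is m'.+1 then
    let: (c, l) := run_state k x m' in
    if x m' then (if l.+1 == k then (c.+1, 0%N) else (c, l.+1)) else (c, 0%N)
  else (0%N, 0%N).

Definition run_count (k : nat) (x : nat -> bool) (m : nat) : nat :=
  (run_state k x m).1.

(* The value is +oo on the paths on which the r-th run never occurs. *)
Definition waiting_time (R : realType) (k r : nat) (x : nat -> bool) : \bar R :=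
  ereal_inf [set m%:R%:E | m in [set m | run_count k x m = r]].

(* A_i(t) is the value (A i).[t]; the generating function is singular at
   t = 1, and for every other t the identity is between functions of x
   near 0. *)
Definition eulerian_polynomials (R : realType) (A : nat -> {poly R}) : Prop :=
  forall t : R, t != 1 ->
    \forall x \near (0 : R),
      series (fun i => (A i).[t] * (x ^+ i / i`!%:R)) @ \oo -->
      (t - 1) / (t - expR ((t - 1) * x)).

Definition Ctilde (R : realType) (A : nat -> {poly R}) (p : R) (k j : nat) : R :=
  let q := 1 - p in
  1 / (q ^+ j * p ^+ k) *
  ((1 - p ^+ k) * (A j).[p] -
   p ^+ k * \sum_(1 <= i < j.+1) 'C(j, i)%:R * (k%:R * q) ^+ i * (A (j - i)%N).[p]).

(* The sum over the m-tuples (n_1, ..., n_m) of natural numbers such that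
   n_1 + 2 n_2 + ... + m n_m = n; the coordinate n_j is [a] at the ordinal
   j.-1, and the bound n_j <= n built in the type of [a] is no restriction.
   The sum does not depend on m as soon as n <= m, whereas m < n discards the
   partitions of n that have a part larger than m, in particular the term of
   Ctilde_n; the latter is not the n-th moment when m < n (for k = r = m = 1
   and n = 2 it is 2 q^2 / p^2, the second moment being (q + q^2) / p^2). *)
Definition moment_formula (R : realType) (A : nat -> {poly R}) (p : R)
    (k r n m : nat) : R :=
  n`!%:R *
  \sum_(a : {ffun 'I_m -> 'I_n.+1} | (\sum_(j < m) j.+1 * a j == n)%N)
    let s := (\sum_(j < m) a j)%N in
    ((r + s - 1) ^_ s)%:R *
    \prod_(j < m) (1 / (a j)`!%:R * (Ctilde A p k j.+1 / j.+1`!%:R) ^+ a j).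

(* Main.v *)
Require Import Defs.
From HB Require Import structures.
From mathcomp Require Import all_boot all_order all_algebra.
From mathcomp Require Import all_classical all_reals all_analysis.
From mathcomp Require Import measurable_realfun ring lra zify.
From Corelib Require Setoid.

Set Implicit Arguments.
Unset Strict Implicit.
Unset Printing Implicit Defensive.

Import Order.TTheory GRing.Theory Num.Theory.
Import numFieldNormedType.Exports.
Local Open Scope classical_set_scope.
Local Open Scope ring_scope.

(** Let Z_r be the excess Y - r k for r runs, and put E_a = e^(a x).  Look at
the trials up to the first failure or the k-th success, whichever comes first:
a failure at trial l + 1 <= k costs l + 1 trials that count in the excess and
starts afresh, whereas k successes complete a run and cost nothing.  Hence the
law of Z_r satisfies ([excess_probS])

  P(Z_(r+1) = j) = sum_(l < k) q p^l P(Z_(r+1) = j - l - 1) + p^k P(Z_r = j),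

from which all moments are finite ([partial_moment_bounded]) and satisfy the
corresponding recurrence ([momentS]).  For the exponential generating function
F_r of the moments this says F_(r+1) D = p^k F_r with
D = 1 - q sum_(l < k) p^l E_(l+1) ([momentXS]).

On the other side, at t = p and after the change of variable x -> x / q, the
generating function of the Eulerian polynomials is
H = sum_i A_i(p) / q^i x^i / i! = q E_1 / (1 - p E_1) ([eulerX_exp]), and the
definition of the numbers Ctilde_j says that C = sum_(j >= 1) Ctilde_j x^j / j!
is p^(-k) ((1 - p^k) (H - 1) - p^k (E_k - 1) H) ([CtildeX_euler]).  Summing the
geometric progression in D gives D = p^k (1 - C) ([stepX_Ctilde]).  Therefore
F_r = (1 - C)^(-r) = sum_s binom(r + s - 1, s) C^s ([momentX_negbinX]), and the
multinomial expansion of C^s yields the formula ([coef_negbinX]).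

All these identities between power series are only needed up to a fixed order,
so they are stated as congruences of polynomials modulo X^N; the one for H is
obtained from the hypothesis on values near 0 by comparing asymptotic
expansions at 0 ([power_series_taylor], [bigO_at0_eqmodX]).  The law of Z_r is
computed by conditioning on one trial at a time ([hit_event_prob]), and the
integral of Z_r^n is the sum over the values of Z_r because the probabilities
of the finite values add up to the moment of order 0, which is 1
([moment_0]). *)

(** * Polynomials modulo a power of the variable *)

Definition eqmodX (A : comNzRingType) (N : nat) (P Q : {poly A}) : Prop :=
  forall i, (i < N)%N -> P`_i = Q`_i.

Section CongruenceModuloXn.
Variables (A : comNzRingType) (N : nat).
Implicit Types P Q : {poly A}.

#[export] Instance eqmodX_equiv : RelationClasses.Equivalence (@eqmodX A N).
Proof.
split=> [P i //|P Q PQ i iN|P Q S PQ QS i iN]; first by rewrite PQ.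
by rewrite PQ ?QS.
Qed.

#[export] Instance eqmodX_add :
  Morphisms.Proper (Morphisms.respectful (@eqmodX A N)
      (Morphisms.respectful (@eqmodX A N) (@eqmodX A N)))
    (@GRing.add _).
Proof. by move=> P P' PP' Q Q' QQ' i iN; rewrite !coefD PP' ?QQ'. Qed.

#[export] Instance eqmodX_opp :
  Morphisms.Proper (Morphisms.respectful (@eqmodX A N) (@eqmodX A N)) (@GRing.opp _).
Proof. by move=> P P' PP' i iN; rewrite !coefN PP'. Qed.

#[export] Instance eqmodX_mul :
  Morphisms.Proper (Morphisms.respectful (@eqmodX A N)
      (Morphisms.respectful (@eqmodX A N) (@eqmodX A N)))
    (@GRing.mul _).
Proof.
move=> P P' PP' Q Q' QQ' i iN; rewrite !coefM; apply: eq_bigr => j _.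
rewrite PP' ?QQ' //; first exact: leq_ltn_trans (leq_subr _ _) iN.
exact: leq_trans (ltn_ord j) iN.
Qed.

Lemma eq_eqmodX P Q : P = Q -> eqmodX N P Q.
Proof. by move=> ->. Qed.

Lemma eqmodX_sum (I : Type) (s : seq I) (F G : I -> {poly A}) :
  (forall i, eqmodX N (F i) (G i)) ->
  eqmodX N (\sum_(i <- s) F i) (\sum_(i <- s) G i).
Proof. by move=> FG i iN; rewrite !coef_sum; apply: eq_bigr => j _; apply: FG. Qed.

(** A factor with regular constant coefficient can be cancelled: the coefficients
of the cofactor are determined one after the other. *)
Lemma eqmodX_mull_inj P Q Q' : GRing.lreg P`_0 ->
  eqmodX N (P * Q) (P * Q') -> eqmodX N Q Q'.
Proof.
move=> reg PQ; elim/ltn_ind => i IH iN; apply: reg.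
have := PQ i iN; rewrite !coefM !big_ord_recl /= subn0.
have -> : \sum_(j < i) P`_(bump 0 j) * Q`_(i - bump 0 j) =
          \sum_(j < i) P`_(bump 0 j) * Q'`_(i - bump 0 j).
  apply: eq_bigr => j _; have lt : (i - bump 0 j < i)%N.
    by rewrite /bump /= ltn_subrL /= (leq_ltn_trans _ (ltn_ord j)).
  by rewrite (IH _ lt (ltn_trans lt iN)).
by move/addIr.
Qed.

Lemma eqmodX_exp_0 P s : P`_0 = 0 -> (N <= s)%N -> eqmodX N (P ^+ s) 0.
Proof.
move=> P0 Ns i iN; have lt := leq_trans iN Ns.
elim: s i {Ns iN} lt => // s IH i; rewrite ltnS => le; rewrite coef0 exprS coefM.
rewrite big1 // => -[[|j] /= ji] _; first by rewrite P0 mul0r.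
rewrite IH ?coef0 ?mulr0 //; apply: leq_trans le.
by rewrite ltn_subrL /= (leq_ltn_trans _ (ji : (j < i)%N)).
Qed.

End CongruenceModuloXn.

(** The exponential e^(u X) truncated below X^N. *)
Definition expX (A : comUnitRingType) (N : nat) (u : A) : {poly A} :=
  \poly_(i < N) (u ^+ i / i`!%:R).

Section TruncatedExponential.
Variables (A : comUnitRingType) (N : nat).
Hypothesis fact_unit : forall i, (i`!%:R : A) \is a GRing.unit.

Lemma expXD (u v : A) :
  eqmodX N (expX N u * expX N v) (expX N (u + v)).
Proof.
move=> s sN; rewrite coefMr coef_poly sN exprDn mulr_suml.
apply: eq_bigr => i _; rewrite !coef_poly.
rewrite (leq_ltn_trans (leq_subr _ _) sN) (leq_trans (ltn_ord i) sN).
have le : (i <= s)%N by rewrite -ltnS.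
apply: (canRL (mulrK (fact_unit s))); rewrite -(bin_fact le) !natrM -[RHS]mulr_natr.
have/divrr e1 := fact_unit i; have/divrr e2 := fact_unit (s - i)%N.
ring: e1 e2.
Qed.

Lemma expX_sum (I : Type) (s : seq I) (u : I -> A) :
  eqmodX N (\prod_(i <- s) expX N (u i)) (expX N (\sum_(i <- s) u i)).
Proof.
elim: s => [|i s IH]; last by rewrite !big_cons IH expXD.
rewrite !big_nil => -[|i] iN; rewrite coef_poly iN coef1 //=.
  by rewrite divr1.
by rewrite expr0n mul0r.
Qed.
End TruncatedExponential.

(** * The negative binomial series and the multinomial expansion *)

(** The series (1 - C)^(-r), truncated below C^N.  The truncated subtraction makes
it 1 for r = 0, since the binomial at s = 0 is 1 and the others vanish. *)
Definition negbinX (A : comNzRingType) (r N : nat) (C : {poly A}) : {poly A} :=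
  \sum_(s < N) C ^+ s *+ 'C(r + s - 1, s).

Section NegativeBinomialSeries.
Variables (A : comNzRingType) (C : {poly A}).
Hypothesis C0 : C`_0 = 0.

Lemma negbinX0 N : eqmodX N (negbinX 0 N C) 1.
Proof.
case: N => [|N] //; rewrite /negbinX big_ord_recl big1 => [|s _].
  by rewrite expr0 addr0.
by rewrite /bump /= add0n addKn bin_small.
Qed.

(** Pascal's rule turns the product by 1 - C into a telescoping sum. *)
Lemma negbinX_telescope r N :
  negbinX r.+1 N.+1 C * (1 - C) =
  negbinX r N.+1 C - C ^+ N.+1 *+ 'C(r + N, N).
Proof.
elim: N => [|N IH].
  by rewrite /negbinX !big_ord1 !addn0 subSS subn0 !bin0 !mulr1n expr0 mul1r.
rewrite /negbinX 2!(big_ord_recr N.+1) -!/(negbinX _ _ _) mulrDl IH /=.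
have -> : (r.+1 + N.+1 - 1 = (r + N).+1)%N by rewrite addSn subn1 /= addnS.
have -> : (r + N.+1 - 1 = r + N)%N by rewrite addnS subn1.
rewrite addnS binS; move: 'C(_, N.+1) 'C(_, N) => b c.
by rewrite [C ^+ N.+2]exprS; move: (negbinX _ _ _) (C ^+ N.+1) => B D; ring.
Qed.

Lemma negbinXS r N :
  eqmodX N (negbinX r.+1 N C * (1 - C)) (negbinX r N C).
Proof.
case: N => [|N] //; rewrite negbinX_telescope -mulr_natr.
by rewrite (eqmodX_exp_0 C0) // mul0r oppr0 addr0.
Qed.

End NegativeBinomialSeries.

Section MultinomialExpansion.
Variables (R : numFieldType) (m n : nat) (c : 'I_m -> R).

Let C : {poly R} := \sum_(j < m) c j *: 'X^(j.+1).
Let weight (a : {ffun 'I_m -> 'I_n.+1}) : R :=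
  \prod_(j < m) (1 / (a j)`!%:R * c j ^+ a j).

(** The multinomial theorem is read off the identity
prod_j e^(c_j X^(j+1) Y) = e^(C Y): the coefficient of Y^s is C^s / s! on one
side, and on the other the product of truncated exponentials expands as a sum
over functions. *)
Lemma coef_exp_weight s : (s <= n)%N ->
  (C ^+ s)`_n = s`!%:R *
    \sum_(a : {ffun 'I_m -> 'I_n.+1} |
      (\sum_(j < m) j.+1 * a j == n)%N && (\sum_(j < m) a j == s)%N) weight a.
Proof.
move=> sn.
have unitR i : (i`!%:R : R) \is a GRing.unit.
  by rewrite unitfE pnatr_eq0 -lt0n fact_gt0.
have natP i : (i%:R : {poly R}) = i%:R%:P by rewrite rmorph_nat.
have unitP i : (i`!%:R : {poly R}) \is a GRing.unit by rewrite natP rmorph_unit.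
have := expX_sum (N := n.+1) unitP (index_enum 'I_m) (fun j => c j *: 'X^(j.+1)).
move=> /(_ s sn); rewrite [X in _ = X]coef_poly ltnS sn -/C.
move/(canLR (mulrVK (unitP s))) => <-.
rewrite natP mulrC coefCM; congr (_ * _).
transitivity ((\prod_(j < m) \sum_(i < n.+1)
     ((1 / i`!%:R * c j ^+ i) *: 'X^(j.+1 * i))%:P * 'X^i)`_s`_n).
  congr ((_ : {poly {poly R}})`_s`_n); apply: eq_bigr => j _.
  rewrite /expX poly_def; apply: eq_bigr => i _; rewrite -mul_polyC; congr (_%:P * _).
  by rewrite exprZn -exprM natP polyCV mulrC mul_polyC scalerA div1r.
rewrite bigA_distr_bigA /= 2!coef_sum [RHS]big_mkcond /=.
apply: eq_bigr => a _.
rewrite big_split /= -rmorph_prod /= coefCM.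
rewrite (_ : \prod_(i < m) 'X^(a i) = 'X^(\sum_(i < m) a i)%N); last first.
  by rewrite expr_sum.
rewrite coefXn eq_sym scaler_prod.
rewrite (_ : \prod_(i < m) 'X^_ = 'X^(\sum_(j < m) j.+1 * a j)%N :> {poly R}); last first.
  by rewrite expr_sum.
case: eqP => _; last by rewrite mulr0 coef0 andbF.
by rewrite mulr1 coefZ coefXn andbT eq_sym; case: eqP => _; rewrite ?mulr1 ?mulr0.
Qed.

Lemma coef_negbinX r : (negbinX r n.+1 C)`_n =
  \sum_(a : {ffun 'I_m -> 'I_n.+1} | (\sum_(j < m) j.+1 * a j == n)%N)
    let s := (\sum_(j < m) a j)%N in ((r + s - 1) ^_ s)%:R * weight a.
Proof.
rewrite coef_sum /=.
have small a : (\sum_(j < m) j.+1 * a j == n)%N -> (\sum_(j < m) a j < n.+1)%N.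
  by move=> /eqP <-; rewrite ltnS; apply: leq_sum => j _; rewrite leq_pmull.
rewrite [RHS](partition_big (fun a : {ffun 'I_m -> 'I_n.+1} =>
  inord (\sum_(j < m) a j)%N : 'I_n.+1) xpredT) //=.
apply: eq_bigr => s _; rewrite coefMn coef_exp_weight; last by rewrite -ltnS.
rewrite -[_ *+ 'C(_, _)]mulr_natl mulrA -natrM bin_ffact big_distrr /=.
apply: eq_big => [a|a /andP[_ /eqP->] //].
by case an: (_ == n) => //=; rewrite -val_eqE /= inordK ?small.
Qed.

End MultinomialExpansion.

(** * The law of the excess and its moments *)

Section LawOfTheExcess.
Variables (R : realType) (p : R) (k : nat).
Hypotheses (p0 : 0 < p) (p1 : p < 1) (k0 : (0 < k)%N).
Let q : R := 1 - p.

(** The probability that, when l successes of the current run are already there,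
r further runs are completed exactly at the t-th trial from now. *)
Fixpoint hit_prob (r l t : nat) : R :=
  match r, t with
  | 0, 0 => 1
  | 0, _.+1 => 0
  | _.+1, 0 => 0
  | r'.+1, t'.+1 =>
      p * (if l.+1 == k then hit_prob r' 0 t' else hit_prob r l.+1 t') +
      (1 - p) * hit_prob r 0 t'
  end.

Lemma hit_prob_ge0 r l t : 0 <= hit_prob r l t.
Proof.
elim: t r l => [|t IH] [|r] l //=.
by rewrite addr_ge0 ?mulr_ge0 ?subr_ge0 ?(ltW p0) ?(ltW p1) //; case: ifP.
Qed.

(** Each run needs k trials. *)
Lemma hit_prob_small r l t : (l < k)%N -> (t + l < r * k)%N -> hit_prob r l t = 0.
Proof.
elim: t r l => [|t IH] [|r] l lk lt //.
rewrite [LHS]/= (_ : (if _ then _ else _) = 0).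
  by rewrite mulr0 add0r IH ?mulr0 //; lia.
by case: eqP => lk'; rewrite IH //; lia.
Qed.

(** One iterates the recursion until the first failure, or until the d + 1 missing
successes of the run have been obtained. *)
Lemma hit_prob_unroll r l d t : (l + d.+1 = k)%N ->
  hit_prob r.+1 l (t + d.+1) =
  \sum_(i < d.+1) q * p ^+ i * hit_prob r.+1 0 (t + d - i) + p ^+ d.+1 * hit_prob r 0 t.
Proof.
elim: d l => [|d IH] l ld; rewrite addnS [LHS]/=.
  by rewrite (_ : l.+1 == k) ?big_ord1; [rewrite addn0 subn0 expr0 /q; ring|lia].
rewrite (_ : (l.+1 == k) = false); last by lia.
rewrite IH; last by lia.
rewrite [in RHS]big_ord_recl /= addnS subn0 expr0 mulr1 mulrDr mulr_sumr.
rewrite (eq_bigr (fun i : 'I_d.+1 => q * p ^+ bump 0 i *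
    hit_prob r.+1 0 ((t + d).+1 - bump 0 i))) => [|i _].
  by rewrite [p ^+ d.+2]exprS /q; ring.
by rewrite /bump add1n subSS exprS; ring.
Qed.

Definition excess_prob (r j : nat) : R := hit_prob r 0 (j + r * k).

Lemma excess_prob_ge0 r j : 0 <= excess_prob r j.
Proof. exact: hit_prob_ge0. Qed.

Lemma excess_prob0 j : excess_prob 0 j = (j == 0%N)%:R.
Proof. by rewrite /excess_prob mul0n addn0; case: j. Qed.

(** The terms with j <= l vanish because the remaining time would be shorter than
r + 1 runs. *)
Lemma excess_probS r j :
  excess_prob r.+1 j =
  \sum_(l < k) q * p ^+ l * (if (l < j)%N then excess_prob r.+1 (j - l.+1) else 0)
  + p ^+ k * excess_prob r j.
Proof.
rewrite {1}/excess_prob mulSn addnCA addnC -(prednK k0) hit_prob_unroll; last first.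
  by rewrite prednK.
rewrite prednK //; congr (_ + _); apply: eq_bigr => l _; congr (_ * _).
have := ltn_ord l; case: ifP => lj lk.
  by rewrite /excess_prob; congr hit_prob; rewrite mulSn; lia.
by apply: hit_prob_small => //; rewrite mulSn; lia.
Qed.

Lemma sum_geometric : \sum_(l < k) q * p ^+ l = 1 - p ^+ k.
Proof. by rewrite -mulr_sumr -[1 - p ^+ k]opprB subrX1 /q; ring. Qed.

Definition partial_moment (r n M : nat) : R :=
  \sum_(0 <= j < M) j%:R ^+ n * excess_prob r j.

Lemma partial_moment_homo r n : nondecreasing_seq (partial_moment r n).
Proof.
apply/nondecreasing_seqP => M; rewrite /partial_moment big_nat_recr //= lerDl.
by rewrite mulr_ge0 ?excess_prob_ge0.
Qed.

(** The binomial expansion of (i + l + 1)^n, after the shift of the summation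
index by l + 1. *)
Lemma partial_moment_shift r n l M :
  \sum_(0 <= j < M) j%:R ^+ n * (if (l < j)%N then excess_prob r (j - l.+1) else 0) =
  \sum_(i < n.+1) 'C(n, i)%:R * l.+1%:R ^+ (n - i) * partial_moment r i (M - l.+1).
Proof.
have [Ml|lM] := leqP M l.+1.
  rewrite (eqP (_ : (M - l.+1)%N == 0%N)) ?subn_eq0 // big_nat big1; last first.
    by move=> j /andP[_ jM]; rewrite ltnNge (_ : (j <= l)%N) ?mulr0 // -ltnS (leq_trans jM).
  by rewrite big1 // => i _; rewrite /partial_moment big_geq // mulr0.
rewrite (big_cat_nat (n := l.+1)) //=; last exact: ltnW.
rewrite big_nat big1 ?add0r; last first.
  by move=> j /andP[_ jM]; rewrite ltnNge -ltnS jM mulr0.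
rewrite -{1}[l.+1]add0n big_addn /partial_moment.
under [RHS]eq_bigr do rewrite mulr_sumr.
rewrite exchange_big /=; apply: eq_bigr => j _.
rewrite addnK ltnNge (_ : (j + l.+1 <= l)%N = false) /=; last by lia.
rewrite natrD addrC exprDn mulr_suml; apply: eq_bigr => i _.
by rewrite -mulr_natl; ring.
Qed.

Lemma partial_momentS r n M :
  partial_moment r.+1 n M =
  \sum_(l < k) q * p ^+ l *
    (\sum_(i < n.+1) 'C(n, i)%:R * l.+1%:R ^+ (n - i) * partial_moment r.+1 i (M - l.+1))
  + p ^+ k * partial_moment r n M.
Proof.
under [in RHS]eq_bigr do rewrite -partial_moment_shift mulr_sumr.
rewrite exchange_big /= mulr_sumr -big_split /=; apply: eq_bigr => j _.
rewrite excess_probS mulrDr mulrCA; congr (_ + _).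
by rewrite mulr_sumr; apply: eq_bigr => l _; rewrite mulrCA.
Qed.

(** In the recurrence for the partial sums, the moment of order n itself occurs on
the right with total weight sum_(l < k) q p^l = 1 - p^k < 1, and at an earlier
index, so that it can be absorbed in the left-hand side. *)
Lemma partial_moment_bounded r n : exists K, forall M, partial_moment r n M <= K.
Proof.
elim: r n => [|r IHr] n.
  exists 1 => -[|M]; rewrite /partial_moment; first by rewrite big_geq.
  rewrite big_nat_recl // big1 => [|j _]; last by rewrite excess_prob0 mulr0.
  by rewrite excess_prob0 addr0 mulr1 expr0n; case: eqP.
elim/ltn_ind: n => n IHn.
have [Kr HKr] := IHr n.
have [K HK] : exists K : nat -> R, forall i, (i < n)%N ->
    forall M, partial_moment r.+1 i M <= K i.
  have /choice[K HK] : forall i, exists Ki, (i < n)%N ->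
      forall M, partial_moment r.+1 i M <= Ki.
    move=> i; have [i_n|] := ltnP i n; last by exists 0.
    by have [Ki HKi] := IHn _ i_n; exists Ki.
  by exists K.
pose B := \sum_(l < k) q * p ^+ l *
    (\sum_(i < n) 'C(n, i)%:R * l.+1%:R ^+ (n - i) * K i) + p ^+ k * Kr.
have pk0 : 0 < p ^+ k by rewrite exprn_gt0.
(* p^k times the partial sum is at most B *)
exists (B / p ^+ k) => M; rewrite ler_pdivlMr //.
suff : partial_moment r.+1 n M <= B + (1 - p ^+ k) * partial_moment r.+1 n M.
  by rewrite mulrBl mul1r; lra.
rewrite {1}partial_momentS /B addrAC lerD ?(ler_wpM2l (ltW pk0)) //.
rewrite -sum_geometric mulr_suml -big_split /=; apply: ler_sum => l _.
rewrite -mulrDr ler_wpM2l ?mulr_ge0 ?subr_ge0 ?(ltW p1) ?exprn_ge0 ?(ltW p0) //.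
rewrite big_ord_recr /= binn subnn expr0 !mul1r lerD //.
  apply: ler_sum => i _; rewrite ler_wpM2l ?mulr_ge0 ?exprn_ge0 ?ler0n //.
  exact: HK.
by apply: partial_moment_homo; rewrite leq_subr.
Qed.

Definition moment (r n : nat) : R := limn (partial_moment r n).

Lemma cvg_moment r n : partial_moment r n @ \oo --> moment r n.
Proof.
apply: nondecreasing_is_cvgn; first exact: partial_moment_homo.
by have [K HK] := partial_moment_bounded r n; exists K => _ [M _ <-].
Qed.

Lemma moment0 n : moment 0 n = (n == 0%N)%:R.
Proof.
apply/cvg_lim => //; rewrite -(cvg_shiftn 1) /=.
rewrite (_ : (fun _ => _) = cst (n == 0%N)%:R); first exact: cvg_cst.
apply/funext => M; rewrite addn1 /partial_moment big_nat_recl // big1 => [|j _].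
  by rewrite excess_prob0 addr0 mulr1 expr0n.
by rewrite excess_prob0 mulr0.
Qed.

Lemma momentS r n :
  moment r.+1 n =
  \sum_(l < k) q * p ^+ l *
    (\sum_(i < n.+1) 'C(n, i)%:R * l.+1%:R ^+ (n - i) * moment r.+1 i)
  + p ^+ k * moment r n.
Proof.
apply/cvg_lim => //.
rewrite (_ : partial_moment _ _ = fun M => \sum_(l < k) q * p ^+ l *
    (\sum_(i < n.+1) 'C(n, i)%:R * l.+1%:R ^+ (n - i) * partial_moment r.+1 i (M - l.+1))
  + p ^+ k * partial_moment r n M); last by apply/funext => M; exact: partial_momentS.
apply: cvgD; last by apply: cvgMr; exact: cvg_moment.
apply: cvg_big => [|l _]; first exact: add_continuous.
 apply: cvgMr;apply: cvg_big => [|i _]; first exact: add_continuous.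
 apply: cvgMr.
by rewrite -(cvg_shiftn l.+1) /=; under eq_fun do rewrite addnK; exact: cvg_moment.
Qed.

Lemma moment_0 r : moment r 0 = 1.
Proof.
elim: r => [|r IH]; first by rewrite moment0.
have := momentS r 0; rewrite IH mulr1.
under eq_bigr do rewrite big_ord1 bin0 subn0 expr0 !mul1r.
rewrite -mulr_suml sum_geometric => h.
have pk0 : p ^+ k != 0 by rewrite expf_neq0 ?gt_eqF.
apply: (mulfI pk0); lra.
Qed.

End LawOfTheExcess.

(** * Asymptotic expansions at 0 *)

(** Only the behaviour on the right of 0 is recorded; this is enough to identify
the coefficients of a polynomial and makes x^N nonnegative. *)
Definition bigO_at0 (R : realType) (N : nat) (g : R -> R) : Prop :=
  exists2 K : R, 0 <= K & \forall x \near 0^'+, `|g x| <= K * x ^+ N.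

Section AsymptoticsAtZero.
Variable R : realType.
Implicit Types (g h : R -> R) (P : {poly R}).

Lemma bigO_at0D N g h : bigO_at0 N g -> bigO_at0 N h -> bigO_at0 N (fun x => g x + h x).
Proof.
move=> [K K0 gK] [L L0 hL]; exists (K + L); first exact: addr_ge0.
near=> x; rewrite (le_trans (ler_normD _ _)) // mulrDl lerD //.
  by near: x.
by near: x.
Unshelve. all: by end_near. Qed.

Lemma bigO_at0M N M g h : bigO_at0 N g -> bigO_at0 M h ->
  bigO_at0 (N + M) (fun x => g x * h x).
Proof.
move=> [K K0 gK] [L L0 hL]; exists (K * L); first exact: mulr_ge0.
near=> x; rewrite normrM exprD mulrACA ler_pM //.
  by near: x.
by near: x.
Unshelve. all: by end_near. Qed.

Lemma bigO_at0_near N g h : (\forall x \near 0^'+, g x = h x) -> bigO_at0 N g -> bigO_at0 N h.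
Proof.
move=> gh [K K0 gK]; exists K => //; near=> x.
have <- : g x = h x by near: x.
by near: x.
Unshelve. all: by end_near. Qed.

Lemma bigO_at0_poly P : bigO_at0 0 (horner P).
Proof.
exists (\sum_(i < size P) `|P`_i|); first by rewrite sumr_ge0.
near=> x; rewrite mulr1 horner_coef (le_trans (ler_norm_sum _ _ _)) //.
apply: ler_sum => i _; rewrite normrM ler_piMr //.
have x0 : 0 < x by near: x; exact: nbhs_right_gt.
by rewrite normrX exprn_ile1 // ger0_norm ?(ltW x0) //; near: x; apply: nbhs_right_le.
Unshelve. all: by end_near. Qed.

(** The limit at 0 of P is P(0), so P(0) = 0, and one divides P by X. *)
Lemma bigO_at0_eqmodX N P : bigO_at0 N (horner P) -> eqmodX N P 0.
Proof.
elim: N P => // N IH P PO.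
have P0 : P`_0 = 0.
  have [K _ PK] := PO; rewrite -horner_coef0; apply/normr0_eq0/le_anti/andP; split=> //.
  have cvg0 (Q : {poly R}) : Q.[x] @[x --> 0^'+] --> Q.[0].
    exact/cvg_at_right_filter/continuous_horner.
  have : `|P.[x]| - (K *: 'X^(N.+1)).[x] @[x --> 0^'+] --> `|P.[0]| - (K *: 'X^(N.+1)).[0].
    by apply: cvgB; [apply: cvg_norm|]; exact: cvg0.
  rewrite !hornerE expr0n mulr0 subr0 => /cvgr_to_le; apply; near=> x.
  by rewrite !hornerE subr_le0; near: x.
have [Q PQ] : exists Q, P = Q * 'X.
  have /factor_theorem[Q ->] : root P 0 by rewrite /root horner_coef0 P0.
  by exists Q; rewrite subr0.
have QO : bigO_at0 N (horner Q).
  case: PO => K K0 PK; exists K => //; near=> x.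
  have x0 : 0 < x by near: x; exact: nbhs_right_gt.
  have : `|P.[x]| <= K * x ^+ N.+1 by near: x.
  by rewrite PQ !hornerE normrM (gtr0_norm x0) exprSr mulrA ler_pM2r.
by case=> [|i] iN; rewrite coef0 ?P0 // PQ coefMX /= (IH Q QO) ?coef0.
Unshelve. all: by end_near. Qed.

Lemma sum_geometric_le (t : R) N d : 0 <= t <= 1 / 2 ->
  \sum_(N <= i < N + d) t ^+ i <= 2 * t ^+ N.
Proof.
move=> /andP[t0 t1].
suff : \sum_(N <= i < N + d) t ^+ i <= 2 * t ^+ N - 2 * t ^+ (N + d).
  by have : 0 <= t ^+ (N + d) by [rewrite exprn_ge0]; lra.
elim: d => [|d IH]; first by rewrite addn0 big_geq // subrr.
rewrite addnS big_nat_recr ?leq_addr //= exprS.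
have : t * t ^+ (N + d) <= 1 / 2 * t ^+ (N + d) by rewrite ler_wpM2r ?exprn_ge0.
lra.
Qed.

(** Convergence at one point x0 > 0 bounds the terms there by a constant, and for
x <= x0 / 2 the remainder is dominated by a geometric series. *)
Lemma power_series_taylor (u : nat -> R) (f : R -> R) N :
  (\forall x \near (0 : R), series (fun i => u i * x ^+ i) @ \oo --> f x) ->
  bigO_at0 N (fun x => f x - (\poly_(i < N) u i).[x]).
Proof.
move=> [e /= e0 uf].
pose x0 := e / 2; have x00 : 0 < x0 by rewrite /x0; lra.
have /cvgP/cvg_series_bounded[B [Breal HB]] : series (fun i => u i * x0 ^+ i) @ \oo --> f x0.
  by apply: uf; rewrite /= sub0r normrN gtr0_norm // /x0; lra.
pose C := `|B| + 1.
have C0 : 0 <= C by rewrite addr_ge0.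
have {}HB i : `|u i * x0 ^+ i| <= C.
  by apply: HB => //; rewrite /C; have := ler_norm B; lra.
exists (C * 2 / x0 ^+ N); first by rewrite divr_ge0 ?mulr_ge0 ?exprn_ge0 ?(ltW x00).
near=> x.
have xp : 0 < x by near: x; exact: nbhs_right_gt.
have xle : x <= x0 / 2 by near: x; apply: nbhs_right_le; lra.
have {uf} ux : series (fun i => u i * x ^+ i) @ \oo --> f x.
  by apply: uf; rewrite /= sub0r normrN gtr0_norm // (le_lt_trans xle) // /x0; lra.
rewrite (_ : C * 2 / x0 ^+ N * x ^+ N = C * (2 * (x / x0) ^+ N)); last first.
  by rewrite [(x / x0) ^+ _]expr_div_n; ring.
have : (fun M => `|series (fun i => u i * x ^+ i) M - (\poly_(i < N) u i).[x]|) @ \oo -->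
    `|f x - (\poly_(i < N) u i).[x]|.
  by apply: cvg_norm; apply: cvgB => //; exact: cvg_cst.
move/cvgr_to_le; apply; near=> M.
have NM : (N <= M)%N by near: M; exact: nbhs_infty_ge.
rewrite /series /= (big_cat_nat (n := N)) //= horner_poly big_mkord addrAC subrr add0r.
have tx : 0 <= x / x0 <= 1 / 2.
  by rewrite divr_ge0 ?(ltW xp) ?(ltW x00) //= ler_pdivrMr //; lra.
have := sum_geometric_le N (M - N) tx; rewrite subnKC // => geo.
rewrite (le_trans (ler_norm_sum _ _ _)) //.
apply: le_trans (ler_wpM2l C0 geo); rewrite mulr_sumr; apply: ler_sum => i _.
have -> : u i * x ^+ i = u i * x0 ^+ i * (x / x0) ^+ i.
  by rewrite [(x / x0) ^+ _]expr_div_n -mulrA [x ^+ i / _]mulrC mulVKf // expf_neq0 ?gt_eqF.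
rewrite normrM ler_pM // ger0_norm // exprn_ge0 //.
by case/andP: tx.
Unshelve. all: by end_near. Qed.

End AsymptoticsAtZero.

(** * Generating functions of the moments and of the Eulerian polynomials *)

Lemma expR_taylor (R : realType) (N : nat) :
  bigO_at0 N (fun x : R => expR x - (expX N (1 : R)).[x]).
Proof.
have -> : expX N (1 : R) = \poly_(i < N) (i`!%:R)^-1.
  by rewrite /expX; congr (polyseq _); apply: eq_poly => i _; rewrite expr1n div1r.
apply: power_series_taylor; apply: filterE => x.
rewrite (_ : (fun i : nat => _) = exp_coeff x); first exact: is_cvg_series_exp_coeff.
by apply/funext => i; rewrite /exp_coeff /= mulrC.
Qed.

Section GeneratingFunctions.
Variables (R : realType) (p : R) (k : nat) (A : nat -> {poly R}).
Hypotheses (p0 : 0 < p) (p1 : p < 1) (k0 : (0 < k)%N).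
Hypothesis eulerA : eulerian_polynomials A.
Let q : R := 1 - p.
Let q_gt0 : 0 < q. Proof. by rewrite subr_gt0. Qed.

(** The generating function of the Eulerian polynomials at p, in the variable
x / q. *)
Definition eulerX (N : nat) : {poly R} :=
  \poly_(i < N) ((A i).[p] / (1 - p) ^+ i / i`!%:R).

Lemma eulerX_taylor N :
  bigO_at0 N (fun x => (p - 1) / (p - expR (- x)) - (eulerX N).[x]).
Proof.
apply: power_series_taylor.
have : x / q @[x --> (0 : R)] --> (0 : R).
  by rewrite -[X in _ --> X](mul0r q^-1); apply: cvgMl; exact: cvg_id.
have p_neq1 : p != 1 by rewrite lt_eqF.
move=> /(_ _ (eulerA p_neq1)) near_q; near=> x.
have : series (fun i => (A i).[p] * ((x / q) ^+ i / i`!%:R)) @ \oo -->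
    (p - 1) / (p - expR ((p - 1) * (x / q))) by near: x.
rewrite (_ : (p - 1) * (x / q) = - x); last by rewrite /q; field; rewrite subr_eq0 eq_sym.
rewrite (_ : (fun i : nat => _ * _) = fun i => (A i).[p] / (1 - p) ^+ i / i`!%:R * x ^+ i) //.
by apply/funext => i; rewrite expr_div_n /q; ring.
Unshelve. all: by end_near. Qed.

(** For small x > 0 the function f(x) = (p - 1) / (p - e^(-x)) satisfies
f(x) (1 - p e^x) = q e^x.  Replacing f and the exponential by their expansions
of order N, the difference of the two sides is O(x^N). *)
Lemma eulerX_exp N :
  eqmodX N (eulerX N * (1 - p%:P * expX N 1)) (q%:P * expX N 1).
Proof.
set H := eulerX N; set E := expX N 1.
suff : eqmodX N (H * (1 - p%:P * E) - q%:P * E) 0.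
  by move=> h i iN; have /eqP := h i iN; rewrite coefB coef0 subr_eq0 => /eqP.
apply: bigO_at0_eqmodX.
pose f x := (p - 1) / (p - expR (- x)).
have fH : bigO_at0 N (fun x => f x - H.[x]) := eulerX_taylor N.
have f1 : bigO_at0 0 f.
  have := eulerX_taylor 0; apply: bigO_at0_near; near=> x.
  by rewrite /eulerX poly_def big_ord0 horner0 subr0.
have eE : bigO_at0 N (fun x => expR x - E.[x]) := expR_taylor R N.
have fHO := bigO_at0M fH (bigO_at0_poly (p%:P * E - 1)); rewrite addn0 in fHO.
have pf : bigO_at0 0 (fun x => p%:P.[x] * f x) := bigO_at0M (bigO_at0_poly p%:P) f1.
(* f = H + O(x^N) is used in the product with 1 - p E, and e^x = E + O(x^N) in
   f p e^x + q e^x *)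
have := bigO_at0D fHO (bigO_at0M (bigO_at0D pf (bigO_at0_poly q%:P)) eE).
apply: bigO_at0_near; near=> x.
have x0 : 0 < x by near: x; exact: nbhs_right_gt.
have xq : x < q by near: x; exact: nbhs_right_lt.
have pe : p - expR (- x) != 0.
  rewrite subr_eq0 lt_eqF //; have := expR_ge1Dx (- x); rewrite /q in xq; lra.
have : f x * (1 - p * expR x) = q * expR x.
  have e0 : expR x != 0 by rewrite gt_eqF ?expR_gt0.
  rewrite /f /q; move: pe; rewrite expRN; move: (expR x) e0 => e e0 pe.
  have pe1 : p * e - 1 != 0.
    by rewrite -[1 in X in X != _](mulVf e0) -mulrBl mulf_neq0.
  by field; rewrite e0.
rewrite /=; move: (f x) => y; rewrite !(hornerD, hornerN, hornerM, hornerC).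
move: (expR x) (E.[x]) (H.[x]) => e a b.
move=> eqn; lra.
Unshelve. all: by end_near. Qed.

Lemma eulerX_0 N : (0 < N)%N -> (eulerX N)`_0 = 1.
Proof.
move=> N0; have := eulerX_exp N0; rewrite mulrBr mulr1 coefB mulrCA coefCM coef0M coefCM.
rewrite [(expX _ _)`_0]coef_poly N0 expr0 divr1 !mulr1 => h.
by apply: (mulfI (lt0r_neq0 q_gt0)); rewrite mulr1 /q in h *; lra.
Qed.

Let fact_unit i : (i`!%:R : R) \is a GRing.unit.
Proof. by rewrite unitfE pnatr_eq0 -lt0n fact_gt0. Qed.

(** In 1 - stepX the coefficient of x^i / i! is the sum over l < k of
q p^l (l + 1)^i: this is the contribution of a first failure at trial l + 1. *)
Definition stepX (N : nat) : {poly R} :=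
  1 - \sum_(l < k) (q * p ^+ l)%:P * expX N l.+1%:R.

Lemma coef_expX N (u : R) i : (i < N)%N -> (expX N u)`_i = u ^+ i / i`!%:R.
Proof. by move=> iN; rewrite coef_poly iN. Qed.

Definition momentX (r N : nat) : {poly R} := \poly_(i < N) (moment p k r i / i`!%:R).

Lemma momentX0 N : eqmodX N (momentX 0 N) 1.
Proof.
move=> i iN; rewrite coef_poly iN moment0 // coef1.
by case: i iN => [|i] _; rewrite ?divr1 ?mul0r.
Qed.

Lemma momentXS r N :
  eqmodX N (momentX r.+1 N * stepX N) ((p ^+ k)%:P * momentX r N).
Proof.
move=> n nN; rewrite mulrBr mulr1 coefB mulr_sumr coef_sum coefCM !coef_poly nN.
rewrite momentS // mulrDl -mulrA addrAC -[RHS]add0r; congr (_ + _).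
rewrite mulr_suml -sumrB big1 // => l _; rewrite mulrCA coefCM -mulrA -mulrBr.
apply/eqP; rewrite mulf_eq0 subr_eq0; apply/orP; right; apply/eqP.
rewrite mulr_suml coefM; apply: eq_bigr => i _.
have le : (i <= n)%N by rewrite -ltnS.
rewrite coef_poly coef_expX ?(leq_ltn_trans (leq_subr _ _)) // (leq_ltn_trans le) //.
apply: (canLR (mulrK (fact_unit n))); rewrite -(bin_fact le) !natrM.
have/divrr e1 := fact_unit i; have/divrr e2 := fact_unit (n - i)%N.
ring: e1 e2.
Qed.

Lemma one_sub_pexp_lreg N : (0 < N)%N -> GRing.lreg (1 - p%:P * expX N (1 : R))`_0.
Proof.
move=> N0; apply/lregP; rewrite coefB coefCM coef1 coef_expX // expr0 divr1 mulr1 /=.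
by rewrite -/q gt_eqF.
Qed.

(** The terms E_(l+1) p^l form a geometric progression of ratio p E_1. *)
Lemma stepX_exp N : eqmodX N (stepX N * (1 - p%:P * expX N 1))
  (1 - p%:P * expX N 1 - q%:P * expX N 1 * (1 - (p ^+ k)%:P * expX N k%:R)).
Proof.
set E := expX N 1.
have Enat l : eqmodX N (expX N l%:R) (E ^+ l).
  elim: l => [|l IH].
    rewrite expr0 => i iN; rewrite coef_expX // expr0n coef1.
    by case: i iN => [|i] _; rewrite ?divr1 ?mul0r.
  by rewrite exprS -IH -addn1 natrD addrC expXD.
rewrite (Enat k) /stepX.
rewrite (_ : eqmodX N (1 - \sum_(l < k) _ * _) (1 - q%:P * E * \sum_(l < k) (p%:P * E) ^+ l)).
  rewrite rmorphXn /= -exprMn -[1 - (p%:P * E) ^+ k]opprB subrX1.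
  by apply: eq_eqmodX; ring.
rewrite mulr_sumr; apply: eqmodX_add => //; apply: eqmodX_opp; apply: eqmodX_sum => l.
rewrite Enat exprS exprMn rmorphM rmorphXn /=; apply: eq_eqmodX; ring.
Qed.

Section CtildeGeneratingFunction.
Variables (m n : nat).
Hypothesis nm : (n <= m)%N.
Let N := n.+1.

(** It is enough to keep the m first terms, m >= n, to work modulo X^(n+1). *)
Definition CtildeX : {poly R} :=
  \sum_(j < m) (Ctilde A p k j.+1 / j.+1`!%:R) *: 'X^(j.+1).

Lemma coef_CtildeX i : (i < N)%N ->
  CtildeX`_i = if i == 0%N then 0 else Ctilde A p k i / i`!%:R.
Proof.
case: i => [|i] iN; rewrite coef_sum /=.
  by rewrite big1 // => j _; rewrite coefZ coefXn mulr0.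
rewrite (bigD1 (Ordinal (leq_trans (iN : (i < n)%N) nm))) //= coefZ coefXn eqxx mulr1.
rewrite big1 ?addr0 // => j ji; rewrite coefZ coefXn eqSS eq_sym.
by rewrite (_ : (j == i :> nat) = false) ?mulr0 //; apply/negbTE.
Qed.

Lemma CtildeX_euler : eqmodX N ((p ^+ k)%:P * CtildeX)
  ((1 - p ^+ k)%:P * (eulerX N - 1) -
   (p ^+ k)%:P * ((expX N k%:R - 1) * eulerX N)).
Proof.
have pk0 : p ^+ k != 0 by rewrite expf_neq0 ?gt_eqF.
move=> i iN; rewrite coefB !coefCM coef_CtildeX // [(eulerX N - 1)`_i]coefB coef1.
case: i iN => [|i] iN /=.
  rewrite coef0M coefB coef1 coef_expX // eulerX_0 // expr0 divr1 !subrr.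
  by rewrite mul0r !mulr0 subrr.
rewrite subr0; set j := i.+1 in iN *.
have -> : ((expX N k%:R - 1) * eulerX N)`_j =
    (\sum_(1 <= t < j.+1) 'C(j, t)%:R * (k%:R * q) ^+ t * (A (j - t)%N).[p])
    / (q ^+ j * j`!%:R).
  rewrite coefM big_ord_recl coefB coef1 coef_expX // expr0 divr1 subrr mul0r add0r.
  rewrite big_add1 big_mkord mulr_suml; apply: eq_bigr => t _.
  have tj : (t.+1 <= j)%N := ltn_ord t.
  rewrite (_ : (lift ord0 t : nat) = t.+1) // coefB coef1 subr0.
  rewrite coef_expX ?(leq_ltn_trans tj) //.
  rewrite coef_poly (leq_ltn_trans (leq_subr _ _) iN) -/q.
  have fE : j`!%:R = 'C(j, t.+1)%:R * (t.+1`!%:R * (j - t.+1)`!%:R) :> R.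
    by rewrite -!natrM bin_fact.
  have qE : q ^+ j = q ^+ t.+1 * q ^+ (j - t.+1) by rewrite -exprD subnKC.
  rewrite fE qE exprMn.
  have := fact_unit t.+1; have := fact_unit (j - t.+1)%N; rewrite !unitfE => u1 u2.
  have u3 : 'C(j, t.+1)%:R != 0 :> R by rewrite pnatr_eq0 -lt0n bin_gt0.
  have u4 l : q ^+ l != 0 by rewrite expf_neq0 ?gt_eqF.
  move: (t.+1`!%:R) ((j - t.+1)`!%:R) ('C(j, _)%:R) u1 u2 u3 => x y z u1 u2 u3.
  move: (q ^+ t.+1) (q ^+ (j - t.+1)) (u4 t.+1) (u4 (j - t.+1)%N) => v w v0 w0.
  by field; rewrite u1 u2 u3 v0 w0.
rewrite /Ctilde -/q coef_poly iN -/q; move: (\sum_(1 <= t < _) _) => S.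
have := fact_unit j; rewrite unitfE => u1.
have u2 : q ^+ j != 0 by rewrite expf_neq0 ?gt_eqF.
move: (j`!%:R) (q ^+ j) (p ^+ k) u1 u2 pk0 => x y z *.
by field; do ?[apply/andP; split].
Qed.

(** Both sides agree after multiplication by 1 - p E_1, whose constant coefficient
q is regular. *)
Lemma stepX_Ctilde : eqmodX N (stepX N) ((p ^+ k)%:P * (1 - CtildeX)).
Proof.
apply: (eqmodX_mull_inj (one_sub_pexp_lreg (ltn0Sn n))).
rewrite mulrC stepX_exp [_%:P * (1 - CtildeX)]mulrBr mulr1 CtildeX_euler.
set E := expX N 1; set H := eulerX N; set L := expX N k%:R; set a := (p ^+ k)%:P.
have HE : eqmodX N (H * (1 - p%:P * E)) (q%:P * E) := @eulerX_exp N.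
rewrite -HE; apply: eq_eqmodX; rewrite polyCB; ring.
Qed.

(** Both families start at 1 and pass from r + 1 to r on multiplication by 1 - C. *)
Lemma momentX_negbinX r : eqmodX N (momentX r N) (negbinX r N CtildeX).
Proof.
have C0 : CtildeX`_0 = 0 by rewrite coef_CtildeX.
have pk0 : p ^+ k != 0 by rewrite expf_neq0 ?gt_eqF.
elim: r => [|r IH]; first by rewrite momentX0 negbinX0.
apply: (@eqmodX_mull_inj _ _ ((p ^+ k)%:P * (1 - CtildeX))).
  by apply/lregP; rewrite coefCM coefB coef1 C0 subr0 mulr1.
have step : eqmodX N (momentX r.+1 N * stepX N) ((p ^+ k)%:P * momentX r N).
  exact: momentXS.
have stepB : eqmodX N (negbinX r.+1 N CtildeX * (1 - CtildeX)) (negbinX r N CtildeX).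
  exact: negbinXS.
rewrite -{1}stepX_Ctilde mulrC step IH -stepB; apply: eq_eqmodX; ring.
Qed.

End CtildeGeneratingFunction.

End GeneratingFunctions.

Lemma moment_formulaE (R : realType) (p : R) (k : nat) (A : nat -> {poly R})
    (r n m : nat) : 0 < p -> p < 1 -> (0 < k)%N -> eulerian_polynomials A ->
  (n <= m)%N -> moment p k r n = moment_formula A p k r n m.
Proof.
move=> p0 p1 k0 eulerA nm.
have := momentX_negbinX p0 p1 k0 eulerA nm r (ltnSn n).
rewrite coef_negbinX coef_poly ltnSn => /(canRL (mulfVK _)) ->; last first.
  by rewrite pnatr_eq0 -lt0n fact_gt0.
by rewrite mulrC.
Qed.

(** * Trials, runs and the waiting time *)

Section Paths.
Variables (k : nat) (x : nat -> bool).

(** Whether, from trial i on and with l successes already obtained in the current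
run, the r-th further run is completed exactly at the t-th of the following
trials.
In contrast with [run_state], the recursion consumes the earliest trial first:
it matches [hit_prob], and the next trial is independent of the earlier ones. *)
Fixpoint hits (r l i t : nat) : bool :=
  match r, t with
  | 0, t => t == 0%N
  | _.+1, 0 => false
  | r'.+1, t'.+1 =>
      if x i then (if l.+1 == k then hits r' 0 i.+1 t' else hits r l.+1 i.+1 t')
      else hits r 0 i.+1 t'
  end.

Lemma hits_ge r l i t : (l < k)%N -> hits r l i t -> (r * k <= t + l)%N.
Proof.
elim: t r l i => [|t IH] [|r] l i lk //=; case: (x i); last by move/IH; lia.
by case: eqP => lk' /IH; lia.
Qed.

(** An arbitrary starting state is needed for the induction.  The count increases
by at most one at each trial, so the first time at which it is r is also the
time of the r-th run. *)
Lemma hits_run_count r c l i t : run_state k x i = (c, l) -> (c <= r)%N ->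
  hits (r - c) l i t ->
  run_count k x (i + t) = r /\
  forall j, (i <= j < i + t)%N -> run_count k x j <> r.
Proof.
elim: t c l i => [|t IH] c l i st cr.
  case rc: (r - c)%N => [|//] _; split; last by move=> j; lia.
  by rewrite addn0 /run_count st /=; lia.
case rc: (r - c)%N => [//|d] /= h.
suff [c' [l' [st' cr' h']]] : exists c' l',
    [/\ run_state k x i.+1 = (c', l'), (c' <= r)%N & hits (r - c') l' i.+1 t].
  have [e ne] := IH _ _ _ st' cr' h'; split; first by rewrite addnS -addSn.
  move=> j /andP[ij jt]; have [ij'|] := ltnP i j; first by apply: ne; lia.
  by move=> ji; have -> : j = i by [lia]; rewrite /run_count st /=; lia.
move: h; rewrite [run_state _ _ _]/= st; case: (x i).
  case: (l.+1 == k) => h.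
    by exists c.+1, 0%N; split=> //; [lia|rewrite (_ : r - c.+1 = d)%N //; lia].
  by exists c, l.+1; split=> //; rewrite rc.
by move=> h; exists c, 0%N; split=> //; rewrite rc.
Qed.

Lemma run_count_hits r c l i t : run_state k x i = (c, l) -> (c <= r)%N ->
  run_count k x (i + t) = r -> exists t', hits (r - c) l i t'.
Proof.
elim: t c l i => [|t IH] c l i st cr.
  by rewrite addn0 /run_count st /= => ->; exists 0%N; rewrite subnn.
case rc: (r - c)%N => [|d]; first by exists 0%N.
rewrite addnS -addSn; have := IH _ _ i.+1; rewrite [run_state _ _ _]/= st.
case xi: (x i); first case lk: (l.+1 == k).
- move=> /(_ _ _ erefl) h /h [|t' ht']; first lia.
  by exists t'.+1; rewrite /= xi lk -(_ : r - c.+1 = d)%N //; lia.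
- by move=> /(_ _ _ erefl cr) h /h [t' ht']; exists t'.+1; rewrite /= xi lk -rc.
- by move=> /(_ _ _ erefl cr) h /h [t' ht']; exists t'.+1; rewrite /= xi -rc.
Qed.

Lemma waiting_time_hits (R : realType) r N : hits r 0 0 N ->
  waiting_time R k r x = N%:R%:E.
Proof.
rewrite -{1}(subn0 r) => h.
have [rcN rc_lt] := @hits_run_count r 0 0 0 N erefl (leq0n r) h.
apply/eqP; rewrite eq_le; apply/andP; split.
  by apply: ereal_inf_lbound; exists N.
apply: le_ereal_inf_tmp => _ [M rcM <-]; rewrite lee_fin ler_nat leqNgt.
by apply/negP => MN; apply: (rc_lt M).
Qed.

Lemma waiting_time_never (R : realType) r : (forall N, ~ hits r 0 0 N) ->
  waiting_time R k r x = +oo%E.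
Proof.
move=> never; rewrite /waiting_time (_ : [set m | _] = set0) ?image_set0 ?ereal_inf0 //.
apply/seteqP; split=> // N /= rcN.
by have [t] := @run_count_hits r 0 0 0 N erefl (leq0n r) rcN; rewrite subn0 => /never.
Qed.

End Paths.

Section HittingLaw.
Context (R : realType) d (T : measurableType d) (P : probability T R).
Variables (p : R) (k : nat) (X : nat -> {RV P >-> bool}).
Hypotheses (p0 : 0 < p) (p1 : p < 1) (bernX : bernoulli_trials p X).

(** The prefix u of the trials is recorded so that the induction on t can move the
next trial from the random part to the prescribed part. *)
Definition hit_event (u : seq bool) (r l t : nat) : set T :=
  [set w | mkseq (X^~ w) (size u) = u /\ hits k (X^~ w) r l (size u) t].

Let mass (b : bool) : R := if b then p else 1 - p.

Lemma cylinder_prob (u : seq bool) :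
  let E := [set w | mkseq (X^~ w) (size u) = u] in
  measurable E /\ P E = (\prod_(b <- u) mass b)%:E.
Proof.
move=> E.
have EE : E = [set w | forall i, i \in iota 0 (size u) -> [set nth false u i] (X i w)].
  apply/seteqP; split=> w /= h.
    by move=> i; rewrite mem_iota => /= iu; rewrite -[in RHS]h nth_mkseq.
  apply: (@eq_from_nth _ false); rewrite size_mkseq // => i iu.
  by rewrite nth_mkseq // h // mem_iota.
split.
  rewrite EE (_ : [set w | _] =
    \bigcap_(i in [set` iota 0 (size u)]) (X i @^-1` [set nth false u i])) //.
  apply: bigcap_measurableType => i _.
  by rewrite -[X in measurable X]setTI; exact: measurable_funPT.
have [indep lawX] := bernX.
have -> : P E = (\prod_(i <- iota 0 (size u)) P (X i @^-1` [set nth false u i]))%E.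
  by rewrite EE; apply: (indep _ (fun i => [set nth false u i])) => //; exact: iota_uniq.
rewrite -prodEFin -[in RHS](mkseq_nth false u) big_map.
apply: eq_bigr => i _.
rewrite -[LHS]/(distribution P (X i) [set nth false u i]) lawX.
by rewrite /bernoulli_prob (ltW p0) (ltW p1) fsbig_set1.
Qed.

(** The event splits according to the next trial, which is appended to u. *)
Lemma hit_event_prob u r l t :
  measurable (hit_event u r l t) /\
  P (hit_event u r l t) = (hit_prob p k r l t * \prod_(b <- u) mass b)%:E.
Proof.
elim: t r l u => [|t IH] r l u.
  have [mu Pu] := cylinder_prob u; case: r => [|r]; rewrite /hit_event /=.
    by rewrite (_ : [set w | _ /\ _] = [set w | mkseq (X^~ w) (size u) = u]) ?mul1r //;
      apply/seteqP; split=> w /= => [[]|].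
  rewrite (_ : [set w | _ /\ _] = set0) ?measure0 ?mul0r //.
  by apply/seteqP; split=> w //= [].
case: r => [|r].
  rewrite (_ : hit_event _ _ _ _ = set0) ?measure0 ?mul0r //.
  by apply/seteqP; split=> w //= [].
pose rt := if l.+1 == k then r else r.+1.
pose lt := (if l.+1 == k then 0 else l.+1)%N.
pose Et := hit_event (rcons u true) rt lt t.
pose Ef := hit_event (rcons u false) r.+1 0 t.
have [mEt PEt] := IH rt lt (rcons u true).
have [mEf PEf] := IH r.+1 0%N (rcons u false).
have EU : hit_event u r.+1 l t.+1 = Et `|` Ef.
  rewrite /Et /Ef /rt /lt /hit_event; apply/seteqP; split=> w; rewrite /= !size_rcons /=.
    move=> [ew]; case xw: (X (size u) w) => h; [left|right].
      by rewrite mkseqS ew xw; split=> //; case: ifP h.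
    by rewrite mkseqS ew xw.
  move=> [[]|[]] /eqP; rewrite mkseqS eqseq_rcons => /andP[/eqP ew /eqP xw] h.
    by split=> //; rewrite xw; case: ifP h.
  by split=> //; rewrite xw.
have disj : Et `&` Ef = set0.
  apply/seteqP; split=> w //=; rewrite /Et /Ef /hit_event /= !size_rcons => -[[-> _] [+ _]].
  by move=> /eqP; rewrite eqseq_rcons eqxx.
rewrite EU; split; first exact: measurableU.
rewrite measureU // [X in (X + _)%E]PEt [X in (_ + X)%E]PEf -EFinD; congr _%:E.
rewrite -!cats1 !big_cat !big_seq1 /rt /lt /=.
by case: ifP => _; ring.
Qed.

End HittingLaw.

Lemma integral_piecewise_cst d (T : measurableType d) (R : realType)
    (mu : {measure set T -> \bar R}) (E : nat -> set T) (v : nat -> \bar R)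
    (f : T -> \bar R) :
  (forall j, measurable (E j)) -> trivIset setT E -> (forall j, (0 <= v j)%E) ->
  (forall j w, E j w -> f w = v j) ->
  measurable_fun (\bigcup_j E j) f /\
  (\int[mu]_(w in \bigcup_j E j) f w = \sum_(j <oo) v j * mu (E j))%E.
Proof.
move=> mE tE v0 fv.
have mf : measurable_fun (\bigcup_j E j) f.
  apply/measurable_fun_bigcup => // j; apply: (eq_measurable_fun (cst (v j))) => //.
  by move=> w; rewrite inE => /fv ->.
split=> //; rewrite ge0_integral_bigcup //; last by move=> w [j _ /fv ->].
apply: eq_eseriesr => j _; rewrite -integral_cst //.
by apply: eq_integral => w; rewrite inE => /fv.
Qed.

(** * The moments of the excess *)

Theorem mainTheorem5 (R : realType) (d : measure_display) (T : measurableType d)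
    (P : probability T R) (p : R) (k r : nat)
    (X : nat -> {RV P >-> bool}) (A : nat -> {poly R}) (n m : nat)
    (hk : (1 <= k)%N) (hr : (1 <= r)%N) (hp0 : 0 < p) (hp1 : p < 1)
    (hX : bernoulli_trials p X) (hA : eulerian_polynomials A)
    (hn : (1 <= n)%N) (hm : (n <= m)%N) :
  let Y : T -> \bar R := fun w => waiting_time R k r (fun i => X i w) in
  let Z : T -> \bar R := fun w => (Y w - (r * k)%:R%:E)%E in
  (\int[P]_w (Z w ^+ n) = (moment_formula A p k r n m)%:E)%E.
Proof.
move=> Y Z.
(* E j is the event that the excess is j *)
pose E j := hit_event k X [::] r 0 (j + r * k).
have mE j : measurable (E j) by have [] := hit_event_prob k hp0 hp1 hX [::] r 0 (j + r * k).
have PE j : P (E j) = (excess_prob p k r j)%:E.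
  have [_ ->] := hit_event_prob k hp0 hp1 hX [::] r 0 (j + r * k).
  by rewrite big_nil mulr1.
have YE j w : E j w -> Y w = (j + r * k)%:R%:E by move=> [_ hN]; exact: waiting_time_hits.
have tE : trivIset setT E.
  apply/trivIsetP => i j _ _; apply: contraNeq => /set0P[w [/YE + /YE]] => ->.
  by move=> [] /eqP; rewrite eqr_nat eqn_add2r.
have sumE (u : nat -> R) l : (fun M => \sum_(0 <= j < M) u j) @ \oo --> l ->
    (\sum_(j <oo) (u j)%:E)%E = l%:E.
  move=> ul; apply/cvg_lim => //; under eq_fun do rewrite sumEFin.
  by apply: cvg_EFin; [exact: filterE|exact: ul].
set D := \bigcup_j E j.
have mD : measurable D by exact: bigcup_measurable.
have PD : P D = 1%E.
  rewrite measure_semi_bigcup //.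
  transitivity (\sum_(j <oo) (excess_prob p k r j)%:E)%E.
    by apply: eq_eseriesr => j _; exact: PE.
  apply: sumE; rewrite -(moment_0 hp0 hp1 hk r).
  rewrite (_ : (fun M => _) = partial_moment p k r 0); first exact: cvg_moment.
  by apply/funext => M; apply: eq_bigr => j _; rewrite mul1r.
have PDC : P (~` D) = 0%E by rewrite probability_setC // PD subee.
have ZD j w : E j w -> (Z w ^+ n = (j%:R ^+ n)%:E)%E.
  by move=> /YE Yw; rewrite /Z Yw -EFinB natrD addrK EFin_expe.
have ZC w : (~` D) w -> (Z w ^+ n = +oo ^+ n)%E.
  move=> Dw; rewrite /Z /Y waiting_time_never // => N hN; apply: Dw.
  exists (N - r * k)%N => //; split=> //=.
  by rewrite subnK // -[N]addn0; apply: hits_ge hN.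
have v0 j : (0 <= (j%:R ^+ n : R)%:E)%E by rewrite lee_fin exprn_ge0.
have [mZD intD] := integral_piecewise_cst P mE tE v0 ZD.
have mZC : measurable_fun (~` D) (fun w => Z w ^+ n)%E.
  by apply: (eq_measurable_fun (cst (+oo ^+ n)%E)) => // w; rewrite inE => /ZC ->.
(* off D the excess is infinite, on a null set *)
rewrite -(setUv D) ge0_integral_setU //; first last.
- by apply/disj_setPS; rewrite setICr.
- by move=> w [[j _ /ZD ->] //|/ZC ->]; rewrite expe_ge0.
- by apply/measurable_funU => //; exact: measurableC.
- exact: measurableC.
rewrite [X in (_ + X)%E]null_set_integral ?adde0 //; last exact: measurableC.
rewrite intD -(moment_formulaE r hp0 hp1 hk hA hm).
transitivity (\sum_(j <oo) (j%:R ^+ n * excess_prob p k r j)%:E)%E.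
  by apply: eq_eseriesr => j _; rewrite EFinM; congr (_ * _)%E; exact: PE.
by apply: sumE; exact: cvg_moment.
Qed.
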